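(* Let $G=(G_1,\dots,G_m)^\top:\mathbb{R}^n\to\mathcal{I}(\mathbb{R})^m$ with every $G_i$ $gH$-continuously differentiable, let $x^0\in\mathbb{R}^n$, and let $L_0:=\{x\in\mathbb{R}^n: G_i(x)\preceq G_i(x^0)\text{ for every } i\in\Lambda\}$, where $\Lambda=\{1,\dots,m\}$. Assume that (A1) for every $i\in\Lambda$, $\nabla_{gH}G_i$ is $gH$-Lipschitz continuous on $L_0$ with some constant $L_i>0$; and (A2) $L_0$ is bounded. Let $0<\rho<\sigma<1$ and let $\{x^k\},\{d^k\},\{t_k\}$ be an infinite run of the nonlinear conjugate gradient method started at $x^0$ (so $v(x^k)\neq 0$ for all $k$), in which the parameters are given, by one and the same of the following three rules for all $k\ge 1$: $$\beta_k:=\max\{\beta_k^{PRP},0\}\quad\text{or}\quad \beta_k:=\max\{\beta_k^{HS},0\}\quad\text{or}\quad \beta_k:=\max\{\beta_k^{LS},0\},$$ where $$\beta_k^{PRP}:=\frac{-f_{x^k}(v(x^k))+f_{x^{k-1}}(v(x^k))}{-f_{x^{k-1}}(v(x^{k-1}))},\qquad \beta_k^{HS}:=\frac{-f_{x^k}(v(x^k))+f_{x^{k-1}}(v(x^k))}{f_{x^k}(d^{k-1})-f_{x^{k-1}}(d^{k-1})},$$ $$\beta_k^{LS}:=\frac{-f_{x^k}(v(x^k))+f_{x^{k-1}}(v(x^k))}{-f_{x^{k-1}}(d^{k-1})}.$$ If each $t_k>0$ satisfies the standard Wolfe conditions and $d^k$ is a sufficient descent direction of $G$ at $x^k$ for all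 $k\ge0$ (i.e. there is a constant $c>0$ with $f_{x^k}(d^k)\le c\,f_{x^k}(v(x^k))$ for all $k\ge 0$), then $$\liminf_{k\to\infty}\|v(x^k)\|=0 .$$
   Context: Intervals. $\mathcal{I}(\mathbb{R})$ is the set of compact intervals of $\mathbb{R}$. For $P=[p_1,p_2]$, $Q=[q_1,q_2]$ and $\lambda\in\mathbb{R}$: $P\oplus Q=[p_1+q_1,p_2+q_2]$; $\lambda\odot P=P\odot\lambda=[\lambda p_1,\lambda p_2]$ if $\lambda\ge0$ and $[\lambda p_2,\lambda p_1]$ if $\lambda<0$; $P\ominus_{gH}Q=[\min\{p_1-q_1,p_2-q_2\},\max\{p_1-q_1,p_2-q_2\}]$; $\|P\|_{\mathcal{I}(\mathbb{R})}=\max\{|p_1|,|p_2|\}$. Order: $Q\preceq P$ means $q_1\le p_1$ and $q_2\le p_2$. $\|\cdot\|$ is the Euclidean norm on $\mathbb{R}^n$, and $|v|:=(|v_1|,\dots,|v_n|)^\top$. Differentiability. For $\Phi:\mathbb{R}^n\to\mathcal{I}(\mathbb{R})$, the $gH$-partial derivative is $\partial_j^{gH}\Phi(x)=\lim_{h\to0}\frac1h\odot(\Phi(x+he_j)\ominus_{gH}\Phi(x))$, and the $gH$-gradient is $\nabla_{gH}\Phi(x)=(\partial_1^{gH}\Phi(x),\dots,\partial_n^{gH}\Phi(x))^\top\in\mathcal{I}(\mathbb{R})^n$. $\Phi$ is $gH$-differentiable at $x$ if there are a linear interval-valued function $L_x$ (i.e. $L_x(h)=\bigoplus_{j}L_x(e_j)\odot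 h_j$), a remainder $E(h)\in\mathcal{I}(\mathbb{R})$ with $E(h)\to[0,0]$ as $\|h\|\to0$, and $\delta>0$ with $\Phi(x+h)\ominus_{gH}\Phi(x)=L_x(h)\oplus\|h\|\odot E(h)$ for $\|h\|<\delta$; then $L_x(h)=\bigoplus_j\partial_j^{gH}\Phi(x)\odot h_j$. $\Phi$ is $gH$-continuously differentiable if it is $gH$-differentiable everywhere and every component of $\nabla_{gH}\Phi$ is continuous ($\lim_{h\to 0}(\partial^{gH}_j\Phi(x+h)\ominus_{gH}\partial^{gH}_j\Phi(x))=[0,0]$). Write $G_i=[\underline G_i,\overline G_i]$ with endpoint functions $\underline G_i\le\overline G_i$. The $j$-th component of $\nabla_{gH}G_i(x)$ is written $[\underline{\nabla_{gH}G_i}(x)_j,\overline{\nabla_{gH}G_i}(x)_j]$, and by convention the endpoint functions have partial derivatives and this interval is $[\min\{\partial_j\underline G_i(x),\partial_j\overline G_i(x)\},\max\{\partial_j\underline G_i(x),\partial_j\overline G_i(x)\}]$. Thus $\underline{\nabla_{gH}G_i}(x),\overline{\nabla_{gH}G_i}(x)\in\mathbb{R}^n$. $\nabla_{gH}G_i$ is $gH$-Lipschitz continuous on a set $S$ with constant $L_i$ if $\sum_{j=1}^n\|\partial_j^{gH}G_i(x)\ominus_{gH}\partial_j^{gH}G_i(y)\|_{\mathcal{I}(\mathbb{R})}\le L_i\|x-y\|$ for all $x,y\in S$. The function $f_x$ and the direction $v(x)$. For $x\in\mathbb{R}^n$ define $f_x:\mathbb{R}^n\to\mathbb{R}$ (denoted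 $\Psi\circ\Upsilon_x$ in the source) by $$f_x(v):=\max_{i\in\Lambda}\Big[\tfrac12\big(\underline{\nabla_{gH}G_i}(x)+\overline{\nabla_{gH}G_i}(x)\big)^\top v+\tfrac12\big(\overline{\nabla_{gH}G_i}(x)-\underline{\nabla_{gH}G_i}(x)\big)^\top|v|\Big].$$ The function $v\mapsto f_x(v)+\frac12\|v\|^2$ is strongly convex; $v(x)$ denotes its unique minimizer. The method. From $x^0$, for $k=0,1,2,\dots$: $d^0=v(x^0)$, $d^k=v(x^k)+\beta_kd^{k-1}$ for $k\ge1$, and $x^{k+1}=x^k+t_kd^k$ with $t_k>0$. The standard Wolfe conditions on $t_k$ are $$G_i(x^k+t_kd^k)\preceq G_i(x^k)\oplus\big[\rho t_kf_{x^k}(d^k),\ \rho t_kf_{x^k}(d^k)\big]\ \text{for every } i\in\Lambda,\qquad f_{x^k+t_kd^k}(d^k)\ge\sigma f_{x^k}(d^k).$$ *)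

(* Defs.v *)
From HB Require Import structures.
From mathcomp Require Import all_boot all_order all_algebra.
From mathcomp Require Import all_classical all_reals all_analysis.

Set Implicit Arguments.
Unset Strict Implicit.
Unset Printing Implicit Defensive.

Import Order.TTheory GRing.Theory Num.Theory.
Import numFieldNormedType.Exports.

Local Open Scope classical_set_scope.
Local Open Scope ring_scope.

Record citv (R : realType) := CItv { lo : R; hi : R; lo_le_hi : lo <= hi }.

HB.instance Definition _ (R : realType) := gen_eqMixin (citv R).
HB.instance Definition _ (R : realType) := gen_choiceMixin (citv R).

Lemma minr_le_maxr (R : realType) (a b : R) : Num.min a b <= Num.max a b.
Proof. by rewrite ge_min le_max lexx. Qed.

Lemma iscale_subproof (R : realType) (l : R) (P : citv R) :
  (if 0 <= l then l * lo P else l * hi P) <=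
  (if 0 <= l then l * hi P else l * lo P).
Proof.
case: (leP 0 l) => l0; first exact: ler_wpM2l (lo_le_hi P).
exact: ler_wnM2l (ltW l0) _ _ (lo_le_hi P).
Qed.

Section IntervalArithmetic.
Context {R : realType}.
Implicit Types (P Q : citv R) (l a : R).

Definition ipoint a : citv R := CItv (lexx a).

Definition iadd P Q : citv R := CItv (lerD (lo_le_hi P) (lo_le_hi Q)).

Definition iscale l P : citv R := CItv (iscale_subproof l P).

Definition gHsub P Q : citv R :=
  CItv (minr_le_maxr (lo P - lo Q) (hi P - hi Q)).

Definition inorm P : R := Num.max `|lo P| `|hi P|.

Definition ile Q P : bool := (lo Q <= lo P) && (hi Q <= hi P).

Definition icvg {T : Type} (F : T -> citv R) (A : set_system T) P : Prop :=
  inorm (gHsub (F h) P) @[h --> A] --> (0 : R).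

End IntervalArithmetic.

Section EuclideanSpace.
Context {R : realType} {n : nat}.
Implicit Types u v : 'rV[R]_n.

(* The library norm on 'rV_n is the sup norm, hence the definition below. *)
Definition enorm v : R := Num.sqrt (\sum_(j < n) v 0 j ^+ 2).

Definition dotv u v : R := \sum_(j < n) u 0 j * v 0 j.

Definition absv v : 'rV[R]_n := map_mx Num.norm v.

Definition basisv (j : 'I_n) : 'rV[R]_n := delta_mx 0 j.

Definition ebounded (S : set 'rV[R]_n) : Prop :=
  exists M : R, forall x, S x -> enorm x <= M.

End EuclideanSpace.

Section GHDifferentiability.
Context {R : realType} {n : nat}.
Implicit Types (Phi L : 'rV[R]_n -> citv R) (x : 'rV[R]_n) (j : 'I_n).

Definition is_gHpartial Phi j x (P : citv R) : Prop :=
  icvg (fun h : R => iscale h^-1 (gHsub (Phi (x + h *: basisv j)) (Phi x)))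
       0^' P.

(* The value is [0, 0] by default when the limit does not exist. *)
Definition gHpartial Phi j x : citv R :=
  xget (ipoint 0) [set P | is_gHpartial Phi j x P].

Definition ilinear L : Prop :=
  forall h, L h = \big[iadd/ipoint 0]_(j < n) iscale (h 0 j) (L (basisv j)).

Definition gHdifferentiable Phi x : Prop :=
  exists L (E : 'rV[R]_n -> citv R) (delta : R),
    [/\ ilinear L, icvg E (0 : 'rV[R]_n)^' (ipoint 0), 0 < delta &
        forall h, enorm h < delta ->
          gHsub (Phi (x + h)) (Phi x) = iadd (L h) (iscale (enorm h) (E h))].

Definition gHcontinuous (F : 'rV[R]_n -> citv R) x : Prop :=
  icvg (fun h => gHsub (F (x + h)) (F x)) (0 : 'rV[R]_n)^' (ipoint 0).

Definition gHcontinuously_differentiable Phi : Prop :=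
  forall x, gHdifferentiable Phi x /\ forall j, gHcontinuous (gHpartial Phi j) x.

Definition endpoints_have_partials Phi : Prop :=
  forall x j, derivable (fun y => lo (Phi y)) x (basisv j) /\
              derivable (fun y => hi (Phi y)) x (basisv j).

Definition gHgrad_lo Phi x : 'rV[R]_n := \row_j lo (gHpartial Phi j x).
Definition gHgrad_hi Phi x : 'rV[R]_n := \row_j hi (gHpartial Phi j x).

Definition gHgrad_lipschitz_on Phi (S : set 'rV[R]_n) (L : R) : Prop :=
  forall x y, S x -> S y ->
    \sum_(j < n) inorm (gHsub (gHpartial Phi j x) (gHpartial Phi j y))
      <= L * enorm (x - y).

End GHDifferentiability.

(* The objectives are indexed by 'I_m.+1: there is at least one of them. *)
Section Method.
Context {R : realType} {m n : nat}.
Variable G : 'I_m.+1 -> 'rV[R]_n -> citv R.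
Implicit Types (x v d : 'rV[R]_n) (t rho sigma : R).

Definition level_set x0 : set 'rV[R]_n :=
  [set x | forall i, ile (G i x) (G i x0)].

Definition fterm x v (i : 'I_m.+1) : R :=
  2^-1 * dotv (gHgrad_lo (G i) x + gHgrad_hi (G i) x) v +
  2^-1 * dotv (gHgrad_hi (G i) x - gHgrad_lo (G i) x) (absv v).

Definition fdir x v : R :=
  \big[Num.max/fterm x v ord0]_(i < m.+1) fterm x v i.

Definition is_vdir x v : Prop :=
  forall w, fdir x v + 2^-1 * enorm v ^+ 2 <= fdir x w + 2^-1 * enorm w ^+ 2.

(* The set of minimizers is a singleton, by strong convexity. *)
Definition vdir x : 'rV[R]_n := xget 0 [set v | is_vdir x v].

Definition standard_wolfe rho sigma x d t : Prop :=
  (forall i, ile (G i (x + t *: d))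
                 (iadd (G i x) (ipoint (rho * t * fdir x d)))) /\
  sigma * fdir x d <= fdir (x + t *: d) d.

Definition ncg_run x0 (x d : nat -> 'rV[R]_n) (t beta : nat -> R) : Prop :=
  x 0%N = x0 /\ d 0%N = vdir (x 0%N) /\
  forall k, [/\ d k.+1 = vdir (x k.+1) + beta k.+1 *: d k,
                x k.+1 = x k + t k *: d k, 0 < t k & vdir (x k) != 0].

(* In the next three definitions (x', d') is iterate k - 1, x is iterate k. *)
Definition beta_PRP x' x : R :=
  (- fdir x (vdir x) + fdir x' (vdir x)) / (- fdir x' (vdir x')).

Definition beta_HS x' d' x : R :=
  (- fdir x (vdir x) + fdir x' (vdir x)) / (fdir x d' - fdir x' d').

Definition beta_LS x' d' x : R :=
  (- fdir x (vdir x) + fdir x' (vdir x)) / (- fdir x' d').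

Definition PRP_rule (x : nat -> 'rV[R]_n) (beta : nat -> R) : Prop :=
  forall k, beta k.+1 = Num.max (beta_PRP (x k) (x k.+1)) 0.

Definition HS_rule (x d : nat -> 'rV[R]_n) (beta : nat -> R) : Prop :=
  forall k, beta k.+1 = Num.max (beta_HS (x k) (d k) (x k.+1)) 0.

Definition LS_rule (x d : nat -> 'rV[R]_n) (beta : nat -> R) : Prop :=
  forall k, beta k.+1 = Num.max (beta_LS (x k) (d k) (x k.+1)) 0.

Definition sufficient_descent (x d : nat -> 'rV[R]_n) : Prop :=
  exists2 c : R, 0 < c &
    forall k, fdir (x k) (d k) <= c * fdir (x k) (vdir (x k)).

End Method.

(* Main.v *)
(* Each summand of f_x is a linear form in v whose coefficients are endpoints of
   the gH-partial derivatives, chosen by the signs of v; hence f_x is positively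
   homogeneous, f_x(v(x)) = - ||v(x)||^2, and f_x(v) is Lipschitz in x on the
   level set.  The Wolfe conditions give a Zoutendijk estimate
   f_{x^k}(d^k)^2 / ||d^k||^2 -> 0.  If ||v(x^k)|| >= e eventually, sufficient
   descent bounds - f_{x^k}(d^k) below by a positive constant, so
   ||d^k|| -> +oo.  On the other hand each of the three rules yields
   0 <= beta_k <= C ||x^k - x^{k-1}||, and an argument in the style of Gilbert
   and Nocedal shows that ||d^k|| cannot then diverge. *)
Require Import Defs.
From mathcomp Require Import all_boot all_order all_algebra.
From mathcomp Require Import all_classical all_reals all_analysis.
From mathcomp Require Import ring lra.
Import Order.TTheory GRing.Theory Num.Theory.
Import numFieldNormedType.Exports.
Local Open Scope classical_set_scope.
Local Open Scope ring_scope.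

(** * Products and affine recursions of real numbers *)

Lemma prod_le_mean_exp (R : realFieldType) (p : nat) (q : 'I_p -> R) :
  (forall i, 0 <= q i) -> \prod_i q i <= ((\sum_i q i) / p%:R) ^+ p.
Proof.
move=> q0; have := @leif_AGM R 'I_p xpredT q (fun i _ => q0 i).
by rewrite /= cardT size_enum_ord => -[].
Qed.

(** Unrolling keeps the exact product in front of [a k], to be made small by the mean inequality;
    the inhomogeneous part only needs the crude bound [Q]. *)
Lemma affine_recursion_bound (R : realDomainType) (a q : nat -> R) (M Q : R) :
  0 <= M -> (forall k, 0 <= a k) -> (forall k, 0 <= q k <= Q) ->
  (forall k, a k.+1 <= M + q k * a k) ->
  forall k p, a (k + p)%N <=
    M * (\sum_(i < p) Q ^+ i) + (\prod_(i < p) q (k + i)%N) * a k.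
Proof.
move=> M0 a0 q0 ha k; elim=> [|p IH].
  by rewrite addn0 !big_ord0 mulr0 add0r mul1r.
rewrite addnS (le_trans (ha _))// [X in M * X]big_ord_recl big_ord_recr/=.
under eq_bigr do rewrite exprS.
rewrite -mulr_sumr.
have /andP[qk qQ] := q0 (k + p)%N.
have S0 : 0 <= \sum_(i < p) Q ^+ i.
  by apply: sumr_ge0 => i _; rewrite exprn_ge0// (le_trans qk).
have := ler_wpM2l qk IH.
have := ler_wpM2r (mulr_ge0 M0 S0) qQ.
set S := \sum_(i < p) _; set P := \prod_(i < p) _; nra.
Qed.

(** * Unit directions and recursions of conjugate directions *)

Section NormedModule.
Variables (R : realType) (V : normedModType R).
Implicit Types (u v w e : V) (d s x : nat -> V).

Definition unitv v : V := `|v|^-1 *: v.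

Lemma norm_unitv v : v != 0 -> `|unitv v| = 1.
Proof. by move=> v0; rewrite normrZ normfV normr_id mulVf ?normr_eq0. Qed.

Lemma scale_unitv v : `|v| *: unitv v = v.
Proof.
have [->|v0] := eqVneq v 0; first by rewrite normr0 scale0r.
by rewrite scalerA mulfV ?normr_eq0// scale1r.
Qed.

Lemma unitvZ (t : R) v : 0 < t -> unitv (t *: v) = unitv v.
Proof.
move=> t0; rewrite /unitv normrZ scalerA gtr0_norm// invfM -mulrA mulrCA.
by rewrite mulVf ?mulr1 ?gt_eqF.
Qed.

(** As [b >= 0], [b *: e] points along [unitv e]; changing its length to that of [w] costs at most
    [|w - b *: e|] by the reverse triangle inequality, whence the factor 2. *)
Lemma unitv_sub_le (b : R) w e : w != 0 -> e != 0 -> 0 <= b ->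
  `|unitv w - unitv e| <= 2 * `|w - b *: e| / `|w|.
Proof.
move=> w0 e0 b0; have nw : 0 < `|w| by rewrite normr_gt0.
rewrite ler_pdivlMr// mulrC -[X in X * _]normr_id.
rewrite -normrZ scalerBr scale_unitv.
have -> : w - `|w| *: unitv e =
          (w - b *: e) + (b * `|e| - `|w|) *: unitv e.
  by rewrite scalerBl -scalerA scale_unitv addrA subrK.
rewrite (le_trans (ler_normD _ _))// mulr_natl mulr2n lerD2l.
rewrite normrZ norm_unitv// mulr1 -[b]ger0_norm// -normrZ.
by rewrite (le_trans (ler_dist_dist _ _))// ger0_norm// distrC.
Qed.

(** Replacing each [unitv (s j)] by [u] changes the sum by at most half the total length, and this
    half is absorbed on the left. *)
Lemma sum_norm_le s p u : `|u| = 1 ->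
  (forall j : 'I_p, `|unitv (s j) - u| <= 2^-1) ->
  \sum_(j < p) `|s j| <= 2 * `|\sum_(j < p) s j|.
Proof.
move=> u1 su; set S := \sum_(j < p) `|s j|.
have S0 : 0 <= S by apply: sumr_ge0.
have : `|S *: u| <= `|\sum_(j < p) s j| + 2^-1 * S.
  have -> : S *: u = \sum_(j < p) s j - \sum_(j < p) `|s j| *: (unitv (s j) - u).
    rewrite /S scaler_suml -sumrB; apply: eq_bigr => j _.
    by rewrite scalerBr scale_unitv opprB addrC subrK.
  rewrite (le_trans (ler_normB _ _))// lerD2l mulr_sumr.
  rewrite (le_trans (ler_norm_sum _ _ _))//; apply: ler_sum => j _.
  by rewrite normrZ normr_id mulrC ler_wpM2r.
rewrite normrZ u1 mulr1 ger0_norm//; lra.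
Qed.

(* If the directions blew up, then consecutive unit directions would become
   almost equal, so the total length of any p consecutive steps would be at most
   2 D.  By the arithmetic-geometric mean inequality the product of p consecutive
   factors of the recursion for |d k| is then at most 1/2 once p >= 4 C D, so
   that |d k| stays bounded along multiples of p. *)
Lemma conjugate_directions_not_diverging x d (v : nat -> V) (t b : nat -> R)
    (M C D : R) :
  (forall k, d k.+1 = v k.+1 + b k.+1 *: d k) ->
  (forall k, x k.+1 = x k + t k *: d k) -> (forall k, 0 < t k) ->
  (forall k, `|v k| <= M) -> (forall k l, `|x k - x l| <= D) -> 0 <= C ->
  (forall k, 0 <= b k.+1 <= C * `|x k.+1 - x k|) ->
  ~ (`|d k| @[k --> \oo] --> +oo).
Proof.
move=> dE xE t0 vM xD C0 bC dy.
have M0 : 0 <= M by apply: le_trans (vM 0%N).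
have D0 : 0 <= D by apply: le_trans (xD 0%N 0%N).
pose s k := x k.+1 - x k; pose q k := C * `|s k|.
have sE k : s k = t k *: d k by rewrite /s xE addrC addKr.
have q0 k : 0 <= q k <= C * D by rewrite /q mulr_ge0//= ler_wpM2l// xD.
have rec k : `|d k.+1| <= M + q k * `|d k|.
  have /andP[b0 bs] := bC k.
  by rewrite dE (le_trans (ler_normD _ _))// lerD// normrZ ger0_norm// ler_wpM2r.
pose p := (Num.truncn (4 * C * D)).+1.
have hp : 4 * C * D <= p%:R by apply/ltW/truncnS_gt.
have p0 : 0 < p%:R :> R by rewrite ltr0n.
(* Past this threshold [unitv_sub_le] gives [2 * M / |d k.+1| <= 1 / (2 p)], so the direction turns
   by at most 1/2 over [p] steps. *)
have [N hN] : exists N, forall k, (N <= k)%N -> 4 * M * p%:R + 1 <= `|d k|.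
  move/cvgryPge : dy => /(_ (4 * M * p%:R + 1))[N _ hN].
  by exists N.
have dgt k : (N <= k)%N -> 0 < `|d k|.
  move=> /hN; apply: lt_le_trans.
  by rewrite ltr_wpDl// !mulr_ge0// ltW.
have udiff k : (N <= k)%N -> `|unitv (d k.+1) - unitv (d k)| <= (2 * p%:R)^-1.
  move=> Nk; have Nk1 : (N <= k.+1)%N by apply: leqW.
  have /andP[b0 _] := bC k.
  rewrite (le_trans (@unitv_sub_le (b k.+1) _ _ _ _ _))// -?normr_gt0 ?dgt//.
  have -> : d k.+1 - b k.+1 *: d k = v k.+1 by rewrite dE addrK.
  rewrite ler_pdivrMr ?dgt//.
  rewrite [leRHS]mulrC ler_pdivlMr ?mulr_gt0//.
  by have := hN _ Nk1; have := ler_wpM2r (ltW p0) (vM k.+1); lra.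
have udist k j : (N <= k)%N ->
    `|unitv (d (k + j)%N) - unitv (d k)| <= j%:R * (2 * p%:R)^-1.
  move=> Nk; elim: j => [|j IH]; first by rewrite addn0 subrr normr0 mul0r.
  rewrite addnS -natr1 mulrDl mul1r [leRHS]addrC.
  rewrite -(subrK (unitv (d (k + j)%N)) (unitv (d _.+1))) -addrA.
  rewrite (le_trans (ler_normD _ _))// lerD// udiff//.
  exact: leq_trans (leq_addr _ _).
have sums k : (N <= k)%N -> \sum_(j < p) `|s (k + j)%N| <= 2 * D.
  move=> Nk.
  have := @sum_norm_le (fun j => s (k + j)%N) p (unitv (d k)).
  move/(_ _ _)/le_trans; apply.
  - by rewrite norm_unitv// -normr_gt0 dgt.
  - move=> j; rewrite sE unitvZ// (le_trans (udist _ _ _))//.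
    rewrite invfM mulrCA ler_piMr// ler_pdivrMr// mul1r ler_nat.
    exact/ltnW/ltn_ord.
  - rewrite ler_wpM2l//.
    have := telescope_sumr (fun j => x (k + j)%N) (leq0n p).
    rewrite big_mkord addn0; under eq_bigr do rewrite addnS.
    by move=> ->; exact: xD.
have prods k : (N <= k)%N -> \prod_(i < p) q (k + i)%N <= 2^-1.
  move=> Nk; rewrite (le_trans (prod_le_mean_exp _ _ _ _))//.
    by move=> i; case/andP: (q0 (k + i)%N).
  have m0 : 0 <= (\sum_(i < p) q (k + i)%N) / p%:R.
    by rewrite divr_ge0//; apply: sumr_ge0 => i _; case/andP: (q0 (k + i)%N).
  have m1 : (\sum_(i < p) q (k + i)%N) / p%:R <= 2^-1.
    rewrite ler_pdivrMr// /q -mulr_sumr.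
    by have := ler_wpM2l C0 (sums _ Nk); lra.
  by rewrite (le_trans (ler_iXnr _ m0 _))// (le_trans m1)// invf_le1// ler1n.
pose K := M * \sum_(i < p) (C * D) ^+ i.
(* With [B] this maximum, a block of [p] steps yields at most [K + B / 2 <= B]. *)
have bnd j : `|d (N + j * p)%N| <= Num.max `|d N| (2 * K).
  elim: j => [|j IH]; first by rewrite mul0n addn0 le_max lexx.
  have Nj : (N <= N + j * p)%N by apply: leq_addr.
  have := affine_recursion_bound _ (fun k => `|d k|) q M (C * D) M0
    (fun=> normr_ge0 _) q0 rec (N + j * p)%N p.
  rewrite -/K -addnA -[X in (_ + X)%N]mulSnr => /le_trans; apply.
  have KB : 2 * K <= Num.max `|d N| (2 * K) by rewrite le_max lexx orbT.
  have P0 : 0 <= \prod_(i < p) q (N + j * p + i)%N.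
    by apply: prodr_ge0 => i _; case/andP: (q0 (N + j * p + i)%N).
  by have := ler_pM P0 (normr_ge0 _) (prods _ Nj) IH; lra.
have [N' hN'] : exists N', forall k, (N' <= k)%N ->
    Num.max `|d N| (2 * K) + 1 <= `|d k|.
  by move/cvgryPge : dy => /(_ (Num.max `|d N| (2 * K) + 1))[N' _ h]; exists N'.
have /hN' : (N' <= N + N' * p)%N.
  by rewrite (leq_trans (leq_pmulr _ _) (leq_addl _ _)).
by have := bnd N'; lra.
Qed.
End NormedModule.

(** * The Zoutendijk estimate *)

(** Sufficient decrease makes [g] nonincreasing; bounded below, it converges, so its decrements
    vanish, and they dominate the squares. *)
Lemma zoutendijk (R : realType) (g F N t : nat -> R) (rho sigma K : R) :
  0 < rho -> sigma < 1 -> 0 < K -> has_lbound (range g) ->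
  (forall k, F k <= 0) -> (forall k, 0 < N k) -> (forall k, 0 < t k) ->
  (forall k, g k.+1 <= g k + rho * t k * F k) ->
  (forall k, (1 - sigma) * - F k <= K * t k * N k ^+ 2) ->
  (F k / N k) ^+ 2 @[k --> \oo] --> (0 : R).
Proof.
move=> rho0 sigma1 K0 gb F0 N0 t0 armijo curv.
have gdec : {homo g : n m / (n <= m)%N >-> m <= n}.
  apply/nonincreasing_seqP => k; apply: le_trans (armijo k) _.
  by rewrite gerDl mulr_ge0_le0 ?F0// mulr_ge0// ltW.
have gcv := nonincreasing_is_cvgn gdec gb.
have dcv : g k - g k.+1 @[k --> \oo] --> (0 : R).
  rewrite -(subrr (limn g)); apply: cvgB => //.
  by rewrite -(cvg_shiftS g) in gcv *.
(* The curvature hypothesis bounds [t k] below by [(1 - sigma) * - F k / (K * N k ^+ 2)]; inserted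
   in the decrement [rho * t k * - F k], this gives [c]. *)
pose c := rho * (1 - sigma) / K.
have c0 : 0 < c by rewrite divr_gt0// mulr_gt0// subr_gt0.
have le k : (F k / N k) ^+ 2 <= c^-1 * (g k - g k.+1).
  rewrite expr_div_n ler_pdivrMr ?exprn_gt0//.
  rewrite -mulrA -ler_pdivrMl ?invr_gt0// invrK /c.
  rewrite mulrAC ler_pdivrMr//.
  have := ler_wpM2l (mulr_ge0 (ltW rho0) _) (curv k); move/(_ (- F k)).
  have : 0 <= - F k by rewrite oppr_ge0.
  move=> nF /(_ nF) H1.
  have H2 : rho * t k * - F k <= g k - g k.+1 by have := armijo k; lra.
  have := ler_wpM2r (mulr_ge0 (ltW K0) (sqr_ge0 (N k))) H2; lra.
apply: (@squeeze_cvgr _ _ _ _ (fun=> 0) (fun k => c^-1 * (g k - g k.+1))).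
- by apply: nearW => k; rewrite sqr_ge0 le.
- exact: cvg_cst.
- by rewrite -(mulr0 c^-1); apply: cvgM => //; exact: cvg_cst.
Qed.

(** * Norms of intervals and vectors; continuity of lower endpoints *)

Section Intervals.
Context {R : realType}.
Implicit Types (P Q : citv R) (l a : R).

Lemma inorm_ge0 P : 0 <= inorm P.
Proof. by rewrite le_max normr_ge0. Qed.

Lemma inormE_le P a : (inorm P <= a) = (`|lo P| <= a) && (`|hi P| <= a).
Proof. by rewrite ge_max. Qed.

Lemma inorm_gHsub P Q :
  inorm (gHsub P Q) = Num.max `|lo P - lo Q| `|hi P - hi Q|.
Proof.
rewrite /inorm /=; have [//|_] := leP (lo P - lo Q) (hi P - hi Q).
exact: maxC.
Qed.

Lemma inorm_iadd P Q : inorm (iadd P Q) <= inorm P + inorm Q.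
Proof.
rewrite inormE_le /=; apply/andP; split; rewrite (le_trans (ler_normD _ _))//;
  by rewrite lerD// le_max lexx ?orbT.
Qed.

Lemma inorm_iscale l P : inorm (iscale l P) = `|l| * inorm P.
Proof.
rewrite /inorm /= maxr_pMr// -!normrM; case: ifP => // _; exact: maxC.
Qed.

End Intervals.

Section SupNorm.
Context {R : realType} {n : nat}.
Implicit Types (u v : 'rV[R]_n).

Lemma coord_le_norm v j : `|v 0 j| <= `|v|.
Proof.
rewrite [leRHS]/Num.Def.normr /= mx_normrE.
by apply/bigmax_geP; right => /=; exists (0, j).
Qed.

Lemma norm_le_enorm v : `|v| <= enorm v.
Proof.
rewrite [leLHS]/Num.Def.normr /= mx_normrE bigmax_le ?sqrtr_ge0// => -[i j] _ /=.
rewrite ord1 -sqrtr_sqr ler_wsqrtr// (bigD1 j)//= lerDl.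
by apply: sumr_ge0 => k _; apply: sqr_ge0.
Qed.

Lemma enorm_le_norm v : enorm v <= n%:R * `|v|.
Proof.
have nv0 : 0 <= n%:R * `|v| by rewrite mulr_ge0.
rewrite -[leRHS]ger0_norm// -sqrtr_sqr ler_wsqrtr// exprMn.
have : \sum_(j < n) v 0 j ^+ 2 <= \sum_(j < n) `|v| ^+ 2.
  apply: ler_sum => j _; rewrite -[v 0 j ^+ 2]ger0_norm ?sqr_ge0// normrX.
  by rewrite lerXn2r ?nnegrE// coord_le_norm.
move=> /le_trans; apply; rewrite sumr_const card_ord -[leLHS]mulr_natl ler_wpM2r//.
by rewrite -natrX ler_nat; case: (n) => // k; rewrite leq_pmulr.
Qed.

Lemma sqr_enormZ (s : R) v : enorm (s *: v) ^+ 2 = s ^+ 2 * enorm v ^+ 2.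
Proof.
rewrite !sqr_sqrtr ?mulr_sumr; try by apply: sumr_ge0 => k _; apply: sqr_ge0.
by apply: eq_bigr => j _; rewrite mxE exprMn.
Qed.

Lemma enorm_ge0 v : 0 <= enorm v.
Proof. exact: sqrtr_ge0. Qed.
End SupNorm.

(** Near 0 the remainder has norm at most 1 and the linear part at most [C * |h|], so the increment
    is bounded by a multiple of [|h|]. *)
Lemma gHdifferentiable_lo_continuous (R : realType) (n : nat)
    (Phi : 'rV[R]_n -> citv R) (x : 'rV[R]_n) :
  gHdifferentiable Phi x -> {for x, continuous (fun y => lo (Phi y))}.
Proof.
move=> [L [E [delta [Llin Ecv delta0 PhiE]]]].
pose C := \sum_(j < n) inorm (L (basisv j)).
have Lh h : inorm (L h) <= `|h| * C.
  rewrite Llin /C mulr_sumr.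
  elim/big_ind2 : _ => [|P a Q b Pa Qb|j _].
  - by rewrite /inorm /= normr0 maxxx.
  - by rewrite (le_trans (inorm_iadd _ _))// lerD.
  - by rewrite inorm_iscale ler_wpM2r ?inorm_ge0// coord_le_norm.
(* [n.+1] keeps the divisor positive even for [n = 0]. *)
have Cn : 0 < C + n.+1%:R.
  by rewrite ltr_wpDl// sumr_ge0// => j _; exact: inorm_ge0.
have near_bound : \forall h \near (0 : 'rV[R]_n),
    `|lo (Phi (x + h)) - lo (Phi x)| <= `|h| * (C + n%:R).
  have E1 : \forall h \near (0 : 'rV[R]_n)^', inorm (E h) <= 1.
    move/cvgr0Pnorm_le : Ecv => /(_ _ ltr01).
    apply: filterS => h; rewrite ger0_norm ?inorm_ge0// inorm_gHsub /=.
    by rewrite !subr0.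
  have hd : \forall h \near (0 : 'rV[R]_n), n%:R * `|h| < delta.
    near=> h; rewrite (@le_lt_trans _ _ (n.+1%:R * `|h|))//.
      by rewrite ler_wpM2r// ler_nat.
    rewrite mulrC -ltr_pdivlMr//.
    near: h; apply: (@nbhs0_lt R 'rV[R]_n); exact: divr_gt0.
  move: E1 hd; rewrite /dnbhs /= near_withinE => E1 hd.
  near=> h.
  have [->|h0] := eqVneq h 0; first by rewrite addr0 subrr !normr0 mul0r.
  have hdelta : enorm h < delta.
    by apply: le_lt_trans (enorm_le_norm h) _; near: h.
  have Eh : inorm (E h) <= 1 by move: h0; near: h.
  have : inorm (gHsub (Phi (x + h)) (Phi x)) <= `|h| * (C + n%:R).
    rewrite PhiE// (le_trans (inorm_iadd _ _))// mulrDr lerD//.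
    rewrite inorm_iscale ger0_norm ?enorm_ge0// mulrC.
    rewrite (le_trans (ler_piMl _ Eh)) ?enorm_ge0//.
    by rewrite mulrC enorm_le_norm.
  by apply: le_trans; rewrite inorm_gHsub le_max lexx.
rewrite continuous_shift forE /continuous_at /= add0r.
change (lo (Phi (h + x)) @[h --> (0 : 'rV[R]_n)] --> lo (Phi x)).
have nbhsF : Filter (nbhs (0 : 'rV[R]_n)) := @nbhs_filter 'rV[R]_n 0.
apply/cvgrPdist_le => e e0; near=> h.
rewrite distrC [h + x]addrC.
apply: (@le_trans _ _ (`|h| * (C + n%:R))); first by near: h.
apply: (@le_trans _ _ (`|h| * (C + n.+1%:R))).
  by rewrite ler_wpM2l// lerD2l ler_nat.
rewrite -ler_pdivlMr//; apply: ltW.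
near: h; apply: (@nbhs0_lt R 'rV[R]_n); exact: divr_gt0.
Unshelve. all: by end_near.
Qed.

(** * The function f_x and its minimizer *)

Section DirectionFunction.
Context {R : realType} {m n : nat}.
Variable G : 'I_m.+1 -> 'rV[R]_n -> citv R.
Implicit Types (x y v : 'rV[R]_n).

Lemma endpoint_choice (a b s : R) :
  2^-1 * ((a + b) * s + (b - a) * `|s|) = (if 0 <= s then b else a) * s.
Proof.
by case: (leP 0 s) => s0; [rewrite ger0_norm//; field | rewrite ltr0_norm//; field].
Qed.

Lemma ftermE x v i : fterm G x v i =
  \sum_(j < n) (if 0 <= v 0 j then hi (gHpartial (G i) j x)
                else lo (gHpartial (G i) j x)) * v 0 j.
Proof.
rewrite /fterm /dotv -mulrDr -big_split mulr_sumr; apply: eq_bigr => j _.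
by rewrite -endpoint_choice !mxE addrC [X in 2^-1 * X]addrC.
Qed.

(** The signs of [v] select the same endpoints at [x] and at [y], so coefficients differ by
    differences of matching endpoints. *)
Lemma fterm_sub_le x y v i : fterm G x v i - fterm G y v i <=
  (\sum_(j < n) inorm (gHsub (gHpartial (G i) j x) (gHpartial (G i) j y))) * `|v|.
Proof.
rewrite !ftermE -sumrB mulr_suml; apply: ler_sum => j _.
rewrite -mulrBl (le_trans (ler_norm _))// normrM ler_pM ?coord_le_norm//.
by rewrite inorm_gHsub le_max; case: ifP; rewrite lexx ?orbT.
Qed.

Lemma fterm_ge x v i :
  - (\sum_(j < n) inorm (gHpartial (G i) j x)) * `|v| <= fterm G x v i.
Proof.
rewrite ftermE mulNr mulr_suml -sumrN; apply: ler_sum => j _.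
rewrite lerNl -mulNr (le_trans (ler_norm _))// normrM normrN.
rewrite ler_pM ?coord_le_norm//.
by rewrite le_max; case: ifP; rewrite lexx ?orbT.
Qed.

Lemma fterm_le_fdir x v i : fterm G x v i <= fdir G x v.
Proof. exact: le_bigmax. Qed.

Lemma fdir_sub_le x y v (c : R) :
  (forall i, fterm G x v i - fterm G y v i <= c) ->
  fdir G x v - fdir G y v <= c.
Proof.
move=> xyc; have le i : fterm G x v i <= c + fdir G y v.
  by rewrite -lerBlDr (le_trans _ (xyc i))// lerB// fterm_le_fdir.
by rewrite lerBlDr; apply: bigmax_le.
Qed.

Lemma fdirZ (s : R) x v : 0 <= s -> fdir G x (s *: v) = s * fdir G x v.
Proof.
move=> s0; have fZ i : fterm G x (s *: v) i = s * fterm G x v i.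
  rewrite /fterm mulrDr ![s * (_ * _)]mulrCA /dotv !mulr_sumr.
  by congr (_ + _); apply: eq_bigr => j _; rewrite !mxE ?normrM ?(ger0_norm s0); ring.
rewrite /fdir fZ; under eq_bigr do rewrite fZ.
by elim/big_rec2 : _ => // i a b _ ->; rewrite maxr_pMr.
Qed.

(* Compares the minimizer v with (1 + h) *: v for a small h of the sign
   opposite to that of fdir G x v + enorm v ^+ 2. *)
Lemma fdir_minimizer x v : is_vdir G x v -> fdir G x v = - enorm v ^+ 2.
Proof.
move=> vmin; set E := enorm v ^+ 2; pose A := fdir G x v + E.
have E0 : 0 <= E by apply: sqr_ge0.
(* [D > |A|] keeps [1 + h] nonnegative for [fdirZ]; [D > E / 2] lets the linear term in [h] dominate
   the quadratic one. *)
pose D := E + 1 + `|A|; have D0 : 0 < D by rewrite /D; have := normr_ge0 A; lra.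
pose h := - A / D.
have h1 : 0 <= 1 + h.
  rewrite /h mulNr subr_ge0 ler_pdivrMr// mul1r.
  by rewrite (le_trans (ler_norm _))// /D; lra.
have := vmin ((1 + h) *: v).
rewrite fdirZ// sqr_enormZ -/E => H.
have hD : h * D = - A by rewrite /h mulfVK// gt_eqF.
have fE : fdir G x v = A - E by rewrite /A; ring.
rewrite fE in H *.
have H2 : 0 <= h * A + 2^-1 * h ^+ 2 * E by lra.
suff A0 : A = 0 by rewrite A0 add0r.
apply/eqP; rewrite -sqrf_eq0 eq_le sqr_ge0 andbT.
have H3 : 0 <= (h * A + 2^-1 * h ^+ 2 * E) * (D * D).
  by rewrite mulr_ge0// mulr_ge0// ltW.
have H4 : (h * A + 2^-1 * h ^+ 2 * E) * (D * D) =
          (h * D) * A * D + 2^-1 * (h * D) ^+ 2 * E by ring.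
rewrite H4 hD in H3.
have H5 : A ^+ 2 * (D - 2^-1 * E) <= 0 by lra.
rewrite leNgt; apply/negP => A2.
have H6 : 0 < D - 2^-1 * E by rewrite /D; have := normr_ge0 A; lra.
by have := mulr_gt0 A2 H6; lra.
Qed.

(** [vdir] defaults to 0, so a nonzero value certifies that a minimizer exists. *)
Lemma vdirP x : vdir G x != 0 -> is_vdir G x (vdir G x).
Proof. by rewrite /vdir; case: xgetP => [y _ //|_]; rewrite eqxx. Qed.

Lemma fdir_vdir x : vdir G x != 0 -> fdir G x (vdir G x) = - enorm (vdir G x) ^+ 2.
Proof. by move=> /vdirP/fdir_minimizer. Qed.

End DirectionFunction.

(** * Lower limits and truncated quotients *)

Lemma limn_einf_eq0 (R : realType) (u : nat -> R) :
  (forall k, 0 <= u k) ->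
  (forall e N, 0 < e -> exists2 k, (N <= k)%N & u k < e) ->
  limn_einf (fun k => (u k)%:E) = 0%E.
Proof.
move=> u0 usmall; rewrite limn_einf_lim.
have einfs0 N : einfs (fun k => (u k)%:E) N = 0%E.
  apply/eqP; rewrite eq_le; apply/andP; split.
    apply/lee_addgt0Pr => e e0; have [k Nk uk] := usmall e N e0.
    rewrite add0e (@le_trans _ _ (u k)%:E)//; last by rewrite lee_fin ltW.
    by apply: ereal_inf_lbound; exists k.
  by apply/ereal_infP => _ [k _ <-]; rewrite lee_fin.
rewrite (_ : einfs _ = cst 0%E); first exact: lim_cst.
by apply/funext => N; rewrite einfs0.
Qed.

(** Common to the three rules: [s] will be the step length, and truncation takes care of a negative
    numerator. *)
Lemma truncated_quotient_bound (R : realFieldType) (num den K del s : R) :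
  0 < del -> del <= den -> 0 <= K * s -> num <= K * s ->
  0 <= Num.max (num / den) 0 <= K / del * s.
Proof.
move=> del0 den0 Ks0 numK; have d0 := lt_le_trans del0 den0.
rewrite le_max lexx orbT ge_max mulrAC divr_ge0 ?(ltW del0)// andbT.
rewrite (@le_trans _ _ (K * s / den))//.
  by rewrite ler_wpM2r// invr_ge0 ltW.
by rewrite ler_wpM2l// lef_pV2.
Qed.

(** * Bounds on the level set *)

Section Run.
Context {R : realType} {m n : nat}.
Variables (G : 'I_m.+1 -> 'rV[R]_n -> citv R) (x0 : 'rV[R]_n).
Local Notation L0 := (level_set G x0).

Lemma level_set_fdir_lipschitz :
  (forall i, exists2 L : R, 0 < L & gHgrad_lipschitz_on (G i) L0 L) ->
  exists2 K : R, 0 < K & forall y z v, L0 y -> L0 z ->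
    fdir G y v - fdir G z v <= K * `|y - z| * `|v|.
Proof.
move=> lip; pose Li i := projT1 (cid2 (lip i)).
have Li0 i : 0 < Li i by rewrite /Li; case: cid2.
have Lip i : gHgrad_lipschitz_on (G i) L0 (Li i) by rewrite /Li; case: cid2.
(* The sum serves all objectives at once; [n.+1] passes from Euclidean to sup norm and is positive
   even for [n = 0]. *)
exists ((\sum_i Li i) * n.+1%:R).
  rewrite mulr_gt0// (bigD1 ord0)//= ltr_pwDl// sumr_ge0// => i _.
  exact: ltW.
move=> y z v Ly Lz; apply: fdir_sub_le => i.
rewrite (le_trans (fterm_sub_le _ _ _ _ _))// ler_wpM2r//.
rewrite (le_trans (Lip i _ _ Ly Lz))// -mulrA ler_pM ?enorm_ge0 ?(ltW (Li0 i))//.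
  by rewrite (bigD1 i)//= lerDl sumr_ge0// => j _; exact: ltW.
by rewrite (le_trans (enorm_le_norm _))// ler_wpM2r// ler_nat.
Qed.

(** The level set lies in a compact sup-norm ball, on which the continuous lower endpoint attains
    its minimum. *)
Lemma level_set_lo_lbound i : gHcontinuously_differentiable (G i) ->
  ebounded L0 -> exists B, forall y, L0 y -> B <= lo (G i y).
Proof.
move=> Gd [M hM].
have cpt : compact [set y : 'rV[R]_n | `|y| <= M].
  apply: bounded_closed_compact.
    by exists M; split; [exact: num_real | move=> r Mr y /le_trans; apply; exact: ltW].
  rewrite (_ : [set _ | _] = (fun y : 'rV[R]_n => `|y|) @^-1` [set r | r <= M])//.
  apply: closed_comp => [y _|]; [exact: norm_continuous | exact: closed_le].
have Gc : {within [set y : 'rV[R]_n | `|y| <= M], continuous (fun y => lo (G i y))}.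
  apply: continuous_subspaceT => y.
  by apply: gHdifferentiable_lo_continuous; case: (Gd y).
have Lx0 : L0 x0 by move=> j; rewrite /ile !lexx.
have in_ball y : L0 y -> `|y| <= M.
  by move=> /hM; apply: le_trans; exact: norm_le_enorm.
have [|c _ cmin] := EVT_min_rV _ cpt Gc; first by exists x0; exact: in_ball.
by exists (lo (G i c)) => y /in_ball yM; apply: cmin; rewrite inE.
Qed.

(** For [v = vdir G y], f_y(v) equals minus the squared Euclidean norm of [v], while comparison with
    [x0] bounds it below by a multiple of [- |v|]; divide by [|v|]. *)
Lemma level_set_vdir_bounded (K : R) : 0 < K -> ebounded L0 ->
  (forall y z v, L0 y -> L0 z -> fdir G y v - fdir G z v <= K * `|y - z| * `|v|) ->
  exists M, forall y, L0 y -> vdir G y != 0 -> `|vdir G y| <= M.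
Proof.
move=> K0 [M hM] lip.
have Lx0 : L0 x0 by move=> j; rewrite /ile !lexx.
pose C := \sum_(j < n) inorm (gHpartial (G ord0) j x0).
exists (K * (M + M) + C) => y Ly vy0.
have v0 : 0 < `|vdir G y| by rewrite normr_gt0.
set v := vdir G y in vy0 v0 *.
have h1 := lip x0 y v Lx0 Ly.
have h2 := le_trans (fterm_ge G x0 v ord0) (fterm_le_fdir G x0 v ord0).
rewrite -/C in h2.
have h3 : `|v| ^+ 2 <= enorm v ^+ 2.
  by rewrite lerXn2r ?nnegrE ?enorm_ge0// norm_le_enorm.
have h4 : K * `|x0 - y| * `|v| <= K * (M + M) * `|v|.
  rewrite ler_wpM2r// ler_wpM2l ?(ltW K0)// (le_trans (ler_normB _ _))//.
  by rewrite lerD// (le_trans (norm_le_enorm _))// hM.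
rewrite (fdir_vdir _ _ vy0) -/v in h1.
rewrite -(ler_pM2r v0) -expr2; lra.
Qed.

End Run.

(** * The lower limit along a run of the method *)

Theorem theorem4p2 (R : realType) (m n : nat)
    (G : 'I_m.+1 -> 'rV[R]_n -> citv R) (x0 : 'rV[R]_n) (rho sigma : R)
    (x d : nat -> 'rV[R]_n) (t beta : nat -> R) :
  (forall i, gHcontinuously_differentiable (G i)) ->
  (forall i, endpoints_have_partials (G i)) ->
  (forall i, exists2 L : R, 0 < L &
     gHgrad_lipschitz_on (G i) (level_set G x0) L) ->
  ebounded (level_set G x0) ->
  0 < rho -> rho < sigma -> sigma < 1 ->
  ncg_run G x0 x d t beta ->
  PRP_rule G x beta \/ HS_rule G x d beta \/ LS_rule G x d beta ->
  (forall k, standard_wolfe G rho sigma (x k) (d k) (t k)) ->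
  sufficient_descent G x d ->
  limn_einf (fun k => (enorm (vdir G (x k)))%:E) = 0%E.
Proof.
move=> Gd _ lip bnd rho0 _ sigma1 [x00 [_ run]] rules wolfe [c c0 desc].
have dE k : d k.+1 = vdir G (x k.+1) + beta k.+1 *: d k by case: (run k).
have xE k : x k.+1 = x k + t k *: d k by case: (run k).
have t0 k : 0 < t k by case: (run k).
have vn0 k : vdir G (x k) != 0 by case: (run k).
pose v k := vdir G (x k); pose F k := fdir G (x k) (d k).
have fv k : fdir G (x k) (v k) = - enorm (v k) ^+ 2 by apply: fdir_vdir.
have v0 k : 0 < enorm (v k).
  by rewrite (lt_le_trans _ (norm_le_enorm _))// normr_gt0 vn0.
have Fle k : F k <= - (c * enorm (v k) ^+ 2).
  by rewrite -mulrN -fv; exact: desc.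
have F0 k : F k < 0.
  by rewrite (le_lt_trans (Fle k))// oppr_lt0 mulr_gt0// exprn_gt0.
have d0 k : 0 < `|d k|.
  rewrite normr_gt0; apply/eqP => dk0; have := F0 k.
  by rewrite /F dk0 -(scale0r 0) fdirZ// mul0r ltxx.
(* Sufficient decrease with [F k < 0] keeps the iterates in the level set, where the bounds above
   apply. *)
have xL k : level_set G x0 (x k).
  elim: k => [|k IH] i; first by rewrite x00 /ile !lexx.
  have := IH i; have := (wolfe k).1 i; rewrite -xE /ile /=.
  have tF : rho * t k * F k <= 0.
    by rewrite mulr_ge0_le0 ?(ltW (F0 k))// mulr_ge0// ltW.
  rewrite -/(F k) => /andP[a1 a2] /andP[b1 b2]; apply/andP; split.
    by rewrite (le_trans a1)// (le_trans _ b1)// gerDl.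
  by rewrite (le_trans a2)// (le_trans _ b2)// gerDl.
have [K K0 flip] := level_set_fdir_lipschitz G x0 lip.
have [B lbB] := level_set_lo_lbound G x0 ord0 (Gd ord0) bnd.
have [M vM] := level_set_vdir_bounded G x0 K K0 bnd flip.
have [D xD] : exists D, forall k l, `|x k - x l| <= D.
  have [D hD] := bnd; exists (D + D) => k l.
  rewrite (le_trans (ler_normB _ _))//.
  by rewrite lerD// (le_trans (norm_le_enorm _))// hD.
(* Feeds the Zoutendijk estimate and bounds the HS denominator from below. *)
have curv k : (1 - sigma) * - F k <= fdir G (x k.+1) (d k) - F k.
  by have := (wolfe k).2; rewrite -xE -/(F k); lra.
have zou : (F k / `|d k|) ^+ 2 @[k --> \oo] --> (0 : R).
  apply: (zoutendijk _ (fun k => lo (G ord0 (x k))) _ _ t rho sigma K) => //.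
  - by exists B => _ [k _ <-]; exact: lbB.
  - by move=> k; exact: ltW.
  - by move=> k; have := (wolfe k).1 ord0; rewrite -xE => /andP[].
  - move=> k; rewrite (le_trans (curv k))//.
    rewrite (le_trans (flip _ _ _ (xL k.+1) (xL k)))//.
    by rewrite xE addrC addKr normrZ gtr0_norm// expr2 !mulrA.
apply: limn_einf_eq0 => [k|e N e0]; first exact: enorm_ge0.
(* Otherwise [enorm (v k) >= e] from [N] on, and sufficient descent keeps [- F k] above [del]. *)
apply: contrapT => nsmall.
have ve k : (N <= k)%N -> e <= enorm (v k).
  by move=> Nk; rewrite leNgt; apply/negP => ?; apply: nsmall; exists k.
pose del := c * e ^+ 2.
have del0 : 0 < del by rewrite mulr_gt0// exprn_gt0.
have Fdel k : (N <= k)%N -> del <= - F k.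
  move=> Nk; rewrite lerNr (le_trans (Fle k))// lerN2 ler_wpM2l ?(ltW c0)//.
  by rewrite lerXn2r ?nnegrE ?enorm_ge0 ?(ltW e0)// ve.
have M0 : 0 <= M by apply: le_trans (vM _ (xL 0%N) (vn0 0%N)).
pose num k := - fdir G (x k.+1) (v k.+1) + fdir G (x k) (v k.+1).
have numle k : num k <= K * M * `|x k.+1 - x k|.
  rewrite /num addrC (le_trans (flip _ _ _ (xL k) (xL k.+1)))// distrC.
  by rewrite mulrAC ler_wpM2r// ler_wpM2l ?(ltW K0)// vM.
have rate den a : 0 < a -> (forall k, (N <= k)%N -> a <= den k) ->
    (forall k, beta k.+1 = Num.max (num k / den k) 0) ->
    exists2 C, 0 <= C &
      forall k, (N <= k)%N -> 0 <= beta k.+1 <= C * `|x k.+1 - x k|.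
  move=> a0 ha hb; exists (K * M / a) => [|k Nk].
    by rewrite divr_ge0 ?(ltW a0)// mulr_ge0// ltW.
  rewrite hb truncated_quotient_bound ?ha//.
  by rewrite mulr_ge0// mulr_ge0// ltW.
have [C C0 betaC] : exists2 C, 0 <= C &
    forall k, (N <= k)%N -> 0 <= beta k.+1 <= C * `|x k.+1 - x k|.
  (* Lower bounds of the denominators: [e ^+ 2], [(1 - sigma) * del] and [del]. *)
  case: rules => [prp|[hs|ls]].
  - apply: rate (exprn_gt0 2 e0) _ prp => k Nk.
    by rewrite fv opprK lerXn2r ?nnegrE ?enorm_ge0 ?(ltW e0)// ve.
  - apply: (rate _ ((1 - sigma) * del)) _ _ hs => [|k Nk].
      by rewrite mulr_gt0// subr_gt0.
    by rewrite (le_trans _ (curv k))// ler_wpM2l ?Fdel// subr_ge0 ltW.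
  - by apply: rate del0 _ ls => k /Fdel.
(* The run is shifted by [N], from where [betaC] holds; divergence of [|d k|] remains to be
   shown. *)
apply: (@conjugate_directions_not_diverging _ _ (fun k => x (k + N)%N)
  (fun k => d (k + N)%N) (fun k => v (k + N)%N) (fun k => t (k + N)%N)
  (fun k => beta (k + N)%N) M C D) => //.
- by move=> k; exact: dE (k + N)%N.
- by move=> k; exact: xE (k + N)%N.
- by move=> k; exact: vM (xL _) (vn0 _).
- by move=> k; apply: betaC; exact: leq_addl.
apply/cvgryPge => A.
have A0 : 0 < `|A| + 1 by have := normr_ge0 A; lra.
(* Once [- F k / |d k|] is below this ratio, [- F k >= del] forces [|d k| >= |A| + 1]. *)
have r0 : 0 < del / (`|A| + 1) by apply: divr_gt0.
have /cvgr0Pnorm_le/(_ _ (exprn_gt0 2 r0))[N' _ hN'] := zou.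
exists N' => // k N'k /=.
have /hN' : (N' <= k + N)%N by apply: leq_trans N'k (leq_addr _ _).
rewrite ger0_norm ?sqr_ge0// -sqrrN -mulNr.
rewrite ler_pXn2r ?nnegrE ?divr_ge0 ?oppr_ge0 ?(ltW (F0 _)) ?(ltW A0) ?(ltW del0)//.
rewrite ler_pdivrMr// => /(le_trans (Fdel _ (leq_addl k N))).
rewrite mulrAC ler_pdivlMr// ler_pM2l//; apply: le_trans.
by have := ler_norm A; lra.
Qed.
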